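(* Let $\mathcal{F}=\{F(\bm{x}|\bm{\gamma})\mid \bm{\gamma}\in\Gamma\}$ be a family of cumulative distribution functions on $\mathbb{R}^m$ with parameter space $\Gamma\subseteq\mathbb{R}^k$, and let $d\in\mathbb{N}$ (the number of ''steps''). Suppose that for any $\bm{\gamma}_1,\bm{\gamma}_2\in\Gamma$ with $\bm{\gamma}_1\neq\bm{\gamma}_2$ there exist a mapping $\mathcal{M}_{\bm{p}}:\mathcal{F}\to\mathcal{G}$, $\mathcal{M}_{\bm{p}}(F(\bm{x}|\bm{\gamma}))=(\phi_1(\bm{p}|\bm{\gamma}),\dots,\phi_d(\bm{p}|\bm{\gamma}))^T$, an index (step) $i\in\{1,\dots,d\}$, and a non-empty set $D_i$ such that: (a) $D_i\subseteq S_i(\bm{\gamma}_1)\cap S_i(\bm{\gamma}_2)$, and $D_i$ does not depend on $\bm{\gamma}_1$ and $\bm{\gamma}_2$; (b) there exist a point $\bm{p}^i_\infty\in\overline{D_i}$, a constant $c_i\neq 1$ and a sequence $\{\bm{p}^i_n\}_{n\in\mathbb{N}}$ in $D_i$ with $\lim_{n\to\infty}\bm{p}^i_n=\bm{p}^i_\infty$ such that $$\frac{\phi_i(\bm{p}^i_n|\bm{\gamma}_2)}{\phi_i(\bm{p}^i_n|\bm{\gamma}_1)}\to c_i\qquad(n\to\infty).$$ Then the family $\{F(\bm{x}|\bm{\gamma})\mid\bm{\gamma}\in\Gamma\}$ is identifiable.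
   Context: Identifiability: the family $\mathcal{F}$ is identifiable if for any $\bm{\gamma}_1,\bm{\gamma}_2\in\Gamma$, $\bm{\gamma}_1\neq\bm{\gamma}_2$ implies $F(\cdot|\bm{\gamma}_1)\neq F(\cdot|\bm{\gamma}_2)$ as functions. Transforms: for each $i\in\{1,\dots,d\}$, $\phi_i(\bm{p}|\bm{\gamma})$ is a complex-valued transform of the distribution function $F(\cdot|\bm{\gamma})$, indexed by $\bm{p}\in\mathbb{R}^m$ (for example, the moment generating function $E_{\bm{\gamma}}[\exp(\bm{p}^T\bm{X})]$). Since $\mathcal{M}_{\bm{p}}$ is a mapping defined on $\mathcal{F}$, $\phi_i(\bm{p}|\bm{\gamma})$ is determined by $F(\cdot|\bm{\gamma})$: if $F(\cdot|\bm{\gamma})=F(\cdot|\bm{\gamma}')$, then $\phi_i(\cdot|\bm{\gamma})=\phi_i(\cdot|\bm{\gamma}')$, with the same domain. Here $\mathcal{G}=\{(\phi_1(\bm{p}|\bm{\gamma}),\dots,\phi_d(\bm{p}|\bm{\gamma}))^T\mid\bm{\gamma}\in\Gamma\}$. The mapping $\mathcal{M}_{\bm{p}}$ is not required to be one-to-one, and some of the $\phi_i$ may coincide. The number $d$ need not equal $k$. Domain: $S_i(\bm{\gamma})=\{\bm{p}\in\mathbb{R}^m\mid \phi_i(\bm{p}|\bm{\gamma})\text{ is well-defined and }|\phi_i(\bm{p}|\bm{\gamma})|<\infty\}$. Closure: $\overline{D_i}$ denotes the closure of $D_i$ under a suitable metric, possibly including points at infinity; for example for $D_i=\mathbb{Z}$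 with metric $d(x,y)=|\tan^{-1}x-\tan^{-1}y|$ one has $\overline{D_i}=\mathbb{Z}\cup\{\pm\infty\}$. The limit $\bm{p}^i_n\to\bm{p}^i_\infty$ is with respect to this metric. Writing the ratio in (b) presupposes that its denominators are nonzero. *)

(* Defs.v *)
From HB Require Import structures.
From mathcomp Require Import all_boot all_order all_algebra.
From mathcomp Require Import all_classical all_reals all_analysis.
From mathcomp Require Export complex.
Set Implicit Arguments.
Unset Strict Implicit.
Unset Printing Implicit Defensive.
Import Order.TTheory GRing.Theory Num.Theory.
Import numFieldNormedType.Exports.
Local Open Scope classical_set_scope.
Local Open Scope ring_scope.
Local Open Scope complex_scope.

Definition borel_rV (R : realType) (m : nat) :=
  g_sigma_algebraType (@open 'rV[R]_m).

Definition is_cdf (R : realType) (m : nat) (G : 'rV[R]_m -> R) : Prop :=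
  exists P : probability (borel_rV R m) R,
    forall x : 'rV[R]_m,
      (G x)%:E = P [set y : 'rV[R]_m | forall j, y ord0 j <= x ord0 j].

Definition identifiable (R : realType) (m k : nat) (Gamma : set 'rV[R]_k)
    (F : 'rV[R]_k -> 'rV[R]_m -> R) : Prop :=
  forall g1 g2 : 'rV[R]_k, Gamma g1 -> Gamma g2 -> g1 <> g2 -> F g1 <> F g2.

(* A transform can be defined at a point and still be infinite there (for
   instance a moment generating function equal to +oo), hence the extended
   complex numbers. *)
Inductive ecomplex (R : realType) : Type :=
  | CFin of R[i]
  | CInfty.
Arguments CInfty {R}.

Definition ecabs (R : realType) (z : ecomplex R) : \bar R :=
  match z with
  | CFin w => (complex.Re `|w|)%:E
  | CInfty => +oo%E
  end.

Definition ecfin (R : realType) (z : ecomplex R) : R[i] :=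
  match z with
  | CFin w => w
  | CInfty => 0
  end.

(* [M p G] is the vector of the d transforms of the function [G] at [p], and
   [None] means "not well-defined".  Only the values of [M p] on the given
   family of distribution functions are ever used, so that a total [M p] is the
   same thing as a map defined on that family alone. *)
Definition transform_map (R : realType) (m d : nat) : Type :=
  'rV[R]_m -> ('rV[R]_m -> R) -> 'I_d -> option (ecomplex R).

Section Transforms.
Variables (R : realType) (m k d : nat).
Variables (M : transform_map R m d) (F : 'rV[R]_k -> 'rV[R]_m -> R).

Definition phi (i : 'I_d) (p : 'rV[R]_m) (g : 'rV[R]_k) :
  option (ecomplex R) := M p (F g) i.

Definition finite_domain (i : 'I_d) (g : 'rV[R]_k) : set 'rV[R]_m :=
  [set p | exists z, phi i p g = Some z /\ (ecabs z < +oo)%E].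

(* The value of a transform as a complex number; the default 0 is only reached
   outside [finite_domain i g]. *)
Definition phi_val (i : 'I_d) (p : 'rV[R]_m) (g : 'rV[R]_k) : R[i] :=
  if phi i p g is Some z then ecfin z else 0.

(* The metric space [E] with the injection [j] of [D] into it stands for the
   choice of a metric on [D] together with possible points at infinity: the
   closure is that of [j @` D] in [E].  The nonvanishing clause is needed because
   [x / 0 = 0] here; [R[i]^o] carries the topology of the modulus. *)
Definition ratio_limit_neq1 (D : set 'rV[R]_m) (i : 'I_d)
    (g1 g2 : 'rV[R]_k) : Prop :=
  exists (E : metricType R) (j : 'rV[R]_m -> E) (pinf : E) (c : R[i])
         (p : nat -> 'rV[R]_m),
    set_inj D j /\ closure (j @` D) pinf /\ c != 1 /\
    (forall n, D (p n)) /\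
    (fun n => j (p n)) @ \oo --> pinf /\
    (forall n, phi_val i (p n) g1 != 0) /\
    (fun n => phi_val i (p n) g2 / phi_val i (p n) g1 : R[i]^o) @ \oo -->
      (c : R[i]^o).

End Transforms.

(* Main.v *)
Require Import Defs.
From mathcomp Require Import all_boot all_order all_algebra.
From mathcomp Require Import all_classical all_reals all_analysis.
Import Order.TTheory GRing.Theory Num.Theory.
Local Open Scope classical_set_scope.
Local Open Scope ring_scope.

(** A transform sees a parameter only through its distribution function.  If two
    distinct parameters had the same distribution function, the two transforms
    in the ratio would agree at every point, the ratio would be constantly 1
    along the sequence, and its limit would be 1 because the complex plane is
    Hausdorff; the hypothesis provides a limit different from 1.  This is
    [ratio_limit_neq1_neq_cdf], which only concerns one pair of parameters. *)

(** The nonvanishing of the denominators is what makes the ratio equal to 1,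
    and not to the conventional value 0 of a division by zero. *)
Lemma ratio_limit_neq1_neq_cdf (R : realType) (m k d : nat)
    (M : transform_map R m d) (F : 'rV[R]_k -> 'rV[R]_m -> R)
    (D : set 'rV[R]_m) (i : 'I_d) (g1 g2 : 'rV[R]_k) :
  ratio_limit_neq1 M F D i g1 g2 -> F g1 <> F g2.
Proof.
move=> [E [j [pinf [c [p [_ [_ [c_neq1 [_ [_ [phi1_neq0 ratio_c]]]]]]]]]]] eqF.
suff c1 : c = 1 by rewrite c1 eqxx in c_neq1.
have ratio1 n : phi_val M F i (p n) g2 / phi_val M F i (p n) g1 = 1.
  have -> : phi_val M F i (p n) g2 = phi_val M F i (p n) g1.
    by rewrite /phi_val /phi eqF.
  exact: divff (phi1_neq0 n).
move: ratio_c; under eq_fun do rewrite ratio1.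
by move=> /(cvg_unique _)-/(_ _ _ (cvg_cst _)); apply; exact: norm_hausdorff.
Qed.

Theorem theorem1 (R : realType) (m k d : nat)
    (Gamma : set 'rV[R]_k) (F : 'rV[R]_k -> 'rV[R]_m -> R)
    (F_cdf : forall g, Gamma g -> is_cdf (F g))
    (D : 'I_d -> set 'rV[R]_m)
    (steps : forall g1 g2 : 'rV[R]_k, Gamma g1 -> Gamma g2 -> g1 <> g2 ->
      exists (M : transform_map R m d) (i : 'I_d),
        [/\ D i !=set0,
            D i `<=` finite_domain M F i g1 `&` finite_domain M F i g2 &
            ratio_limit_neq1 M F (D i) i g1 g2]) :
  identifiable Gamma F.
Proof.
move=> g1 g2 Gg1 Gg2 /(steps g1 g2 Gg1 Gg2)[M [i [_ _]]].
exact: ratio_limit_neq1_neq_cdf.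
Qed.
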